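(* Let $p_1,\dots,p_n$ be distinct primes and $N=p_1^{\alpha_1}\cdots p_n^{\alpha_n}$ with $\alpha_1\ge \alpha_2\ge\cdots\ge \alpha_u>\alpha_{u+1}=\cdots =\alpha_n=1$ (where $u=0$ if $\alpha_1=\cdots=\alpha_n=1$). For a set $\mathcal D$ of positive divisors of $N$, the following statements are equivalent: (a) $\mathcal D$ is a maximal $N$-set with the minimum size; (b) $\mathcal D$ is a maximal $N$-set with $d(\mathcal D)\subseteq \{d : d\mid p_{u+1}\cdots p_n\}$; (c) $\mathcal D=\{dd' : d\mid \frac{N}{p_{u+1}\cdots p_n},\ d'\in \mathcal D'\}$ for some maximal $p_{u+1}\cdots p_n$-set $\mathcal D'$.
   Context: For a positive integer $M$, a set $\mathcal D$ of positive divisors of $M$ is an $M$-set if no two elements of $\mathcal D$ are coprime; an $M$-set is maximal if no additional positive divisor of $M$ can be included in it while keeping the $M$-set property. ''Maximal $N$-set with the minimum size'' means a maximal $N$-set whose cardinality is the minimum of the cardinalities of all maximal $N$-sets (this minimum is known to equal $\alpha_n\prod_{i=1}^{n-1}(\alpha_i+1)$). For a set $\mathcal D$ of positive divisors of $N$, $d(\mathcal D)$ denotes the set of those $d\in\mathcal D$ that are not divisible by any other element of $\mathcal D$. *)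

(* Defs.v *)
From mathcomp Require Import all_boot finmap.

Set Implicit Arguments.
Unset Strict Implicit.
Unset Printing Implicit Defensive.

Local Open Scope fset_scope.

Definition divisor_set (M : nat) (D : {fset nat}) : Prop :=
  forall d, d \in D -> (0 < d) && (d %| M).

(* The two elements need not be distinct, so 1 belongs to no M-set.  With
   distinct elements only, {1} would be a maximal M-set of size 1. *)
Definition Mset (M : nat) (D : {fset nat}) : Prop :=
  divisor_set M D /\
  forall a b, a \in D -> b \in D -> ~~ coprime a b.

Definition maximal_Mset (M : nat) (D : {fset nat}) : Prop :=
  Mset M D /\
  forall d, 0 < d -> d %| M -> d \notin D -> ~ Mset M (d |` D).

Definition min_maximal_Mset (M : nat) (D : {fset nat}) : Prop :=
  maximal_Mset M D /\
  forall E, maximal_Mset M E -> #|` D| <= #|` E|.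

Definition primitive (D : {fset nat}) : {fset nat} :=
  [fset d in D | ~~ has (fun e => (e != d) && (e %| d)) D].

(* Main.v *)
Require Import Defs.
From mathcomp Require Import all_boot finmap.

Local Open Scope fset_scope.

(** In a maximal [N]-set [D], a divisor [x] outside [D] is coprime to some
    [e] in [D], so [e] divides [N / x] and [N / x] is in [D].  Hence [D] holds
    at least half of the divisors of [N], and exactly half iff it never holds
    both [x] and [N / x].  The multiples of a prime dividing [N] exactly once
    form a maximal [N]-set with exactly half of the divisors.  If a primitive
    [x] in [D] is divisible by a prime [q] with [q ^ 2 %| N], then [x / q] is
    not in [D], so [q * (N / x)] is in [D]; it has the same prime factors as
    [N / x], so both [x] and [N / x] lie in [D].  Conversely, when all primitive
    elements divide the squarefree part [P], membership of [x] only depends on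
    [gcdn x P], and the gcds attached to [x] and [N / x] are coprime. *)

(** * Membership in maximal [M]-sets *)

(** Adding [d] can only fail because [d] is coprime to an element of [D] or to itself, and the
    latter means [d = 1]. The resulting equation on membership replaces maximality in what
    follows. *)
Lemma maximal_MsetP (M : nat) (D : {fset nat}) : 1 < M ->
  maximal_Mset M D <->
  forall d, (d \in D) = (d %| M) && all (fun e => ~~ coprime d e) D.
Proof.
move=> M_gt1; have M_gt0 := ltnW M_gt1.
split=> [[[divD copD] maxD] d | defD].
  apply/idP/idP => [dD | /andP[dM /allP /= ncd]].
    have /andP[_ ->] := divD d dD.
    by apply/allP => e eD; apply: copD.
  apply: contraT => dD; have d_gt0 := dvdn_gt0 M_gt0 dM.
  (* The divisor [1] is coprime to itself and cannot be added. It is coprime to everything, so [D]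
     would be empty here, and then [M] itself could be added because [1 < M]. *)
  have [d1 | d_neq1] := eqVneq d 1.
    have D0 e : e \in D -> false.
      by move=> eD; have := ncd e eD; rewrite d1 coprime1n.
    have MD : M \notin D by apply/negP => /D0.
    case: (maxD M M_gt0 (dvdnn M) MD); split=> [a | a b]; rewrite !inE.
      by case/orP=> [/eqP-> | /D0 //]; rewrite M_gt0 /=.
    case/orP=> [/eqP-> | /D0 //]; case/orP=> [/eqP-> | /D0 //].
    by rewrite /coprime gcdnn gtn_eqF.
  case: (maxD d d_gt0 dM dD); split=> [a | a b]; rewrite !inE.
    by case/orP=> [/eqP-> | /divD //]; rewrite d_gt0.
  case/orP=> [/eqP-> | aD] /orP[/eqP-> | bD].
  - by rewrite /coprime gcdnn.
  - exact: ncd.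
  - by rewrite coprime_sym ncd.
  - exact: copD.
split.
  split=> [a | a b]; rewrite defD => /andP[aM /allP nca]; last exact: nca.
  by rewrite aM (dvdn_gt0 M_gt0 aM).
move=> d _ dM; rewrite defD dM /= => /allPn[e eD /negPn cde] [_ copdD].
by have := copdD d e; rewrite !inE eqxx eD orbT cde => /(_ isT isT).
Qed.

Lemma maximal_Mset_notin (M : nat) (D : {fset nat}) (x : nat) : 1 < M ->
  maximal_Mset M D -> x %| M -> x \notin D -> exists2 e, e \in D & coprime x e.
Proof.
move=> M_gt1 /(maximal_MsetP _ _ M_gt1) defD xM; rewrite defD xM /=.
by case/allPn=> e eD /negPn; exists e.
Qed.

Lemma maximal_Mset_dvd (M : nat) (D : {fset nat}) (x y : nat) : 1 < M ->
  maximal_Mset M D -> x \in D -> x %| y -> y %| M -> y \in D.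
Proof.
move=> M_gt1 /(maximal_MsetP _ _ M_gt1) defD xD xy yM; rewrite defD yM /=.
apply/allP => e eD; apply: contraL xD => cye.
by rewrite defD negb_and; apply/orP; right; apply/allPn; exists e => //;
  rewrite negbK (coprime_dvdl xy).
Qed.

(** When [q] divides [x], the numbers [q * x] and [x] have the same prime factors, hence are coprime
    to the same numbers. *)
Lemma maximal_Mset_divp (M : nat) (D : {fset nat}) (q x : nat) : 1 < M ->
  maximal_Mset M D -> q * x \in D -> q %| x -> x \in D.
Proof.
move=> M_gt1 /(maximal_MsetP _ _ M_gt1) defD; rewrite !defD.
case/andP=> qxM /allP /= ncqx qx; rewrite (dvdn_trans (dvdn_mull q (dvdnn x))) //.
apply/allP => e /ncqx; rewrite coprimeMl; apply: contra => cxe.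
by rewrite cxe (coprime_dvdl qx).
Qed.

Lemma maximal_Mset_cofactor (M : nat) (D : {fset nat}) (x : nat) : 1 < M ->
  maximal_Mset M D -> x %| M -> x \notin D -> M %/ x \in D.
Proof.
move=> M_gt1 maxD xM xD; have [e eD cxe] := maximal_Mset_notin _ _ _ M_gt1 maxD xM xD.
apply: (maximal_Mset_dvd _ _ e _ M_gt1 maxD eD); last exact: dvdn_div.
have [[divD _] _] := maxD; have /andP[_ eM] := divD e eD.
by rewrite -(Gauss_dvdr _ (n := x)) 1?coprime_sym // mulnC divnK.
Qed.

Lemma primitive_below (D : {fset nat}) (x : nat) : 0 < x -> x \in D ->
  exists2 e, e \in primitive D & e %| x.
Proof.
elim/ltn_ind: x => x IHx x_gt0 xD.
have [/hasP[e eD /andP[e_neq ex]] | nox] :=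
    boolP (has (fun e => (e != x) && (e %| x)) D).
  have e_lt : e < x by rewrite ltn_neqAle e_neq dvdn_leq.
  have [f fD fe] := IHx e e_lt (dvdn_gt0 x_gt0 ex) eD.
  by exists f => //; apply: dvdn_trans ex.
by exists x; rewrite ?inE //= xD.
Qed.

(** * Counting along the involution [d -> M / d] *)

Lemma perm_divisors_cofactor (M : nat) : 0 < M ->
  perm_eq [seq M %/ d | d <- divisors M] (divisors M).
Proof.
move=> M_gt0; have cofK d : d %| M -> M %/ (M %/ d) = d.
  by move=> dM; rewrite divnA // mulKn.
apply: uniq_perm; rewrite ?divisors_uniq //.
  rewrite map_inj_in_uniq ?divisors_uniq // => a b.
  by rewrite -!dvdn_divisors // => aM bM eq_ab; rewrite -(cofK a) // eq_ab cofK.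
move=> d; apply/mapP/idP => [[e] | ]; rewrite -!dvdn_divisors // => dM.
  by move->; apply: dvdn_div.
by exists (M %/ d); rewrite -?dvdn_divisors ?dvdn_div ?cofK.
Qed.

Lemma card_divisor_set (M : nat) (D : {fset nat}) : 0 < M -> divisor_set M D ->
  #|` D| = count [in D] (divisors M).
Proof.
move=> M_gt0 divD; rewrite -size_filter; apply: perm_size.
apply: uniq_perm; rewrite ?fset_uniq ?filter_uniq ?divisors_uniq // => d.
rewrite mem_filter -dvdn_divisors //=; apply/idP/andP => [dD | [] //].
by have /andP[_ ->] := divD d dD.
Qed.

Lemma card_divisor_set_cofactor (M : nat) (D : {fset nat}) : 0 < M ->
  divisor_set M D -> #|` D| = count [pred d | M %/ d \in D] (divisors M).
Proof.
move=> M_gt0 divD; rewrite (card_divisor_set M) //.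
by rewrite -(permP (perm_divisors_cofactor M M_gt0)) count_map.
Qed.

Lemma maximal_Mset_card_ge (M : nat) (D : {fset nat}) : 1 < M ->
  maximal_Mset M D -> size (divisors M) <= #|` D| + #|` D|.
Proof.
move=> M_gt1 maxD; have M_gt0 := ltnW M_gt1; have [[divD _] _] := maxD.
rewrite -(count_predC [in D] (divisors M)) -card_divisor_set // leq_add2l.
rewrite (card_divisor_set_cofactor M) // -!size_filter.
apply: uniq_leq_size; rewrite ?filter_uniq ?divisors_uniq // => d.
rewrite !mem_filter -dvdn_divisors //= => /andP[dD dM].
by rewrite dM maximal_Mset_cofactor.
Qed.

Lemma maximal_Mset_card_gt (M : nat) (D : {fset nat}) (x : nat) : 1 < M ->
  maximal_Mset M D -> x \in D -> M %/ x \in D ->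
  size (divisors M) < #|` D| + #|` D|.
Proof.
move=> M_gt1 maxD xD MxD; have M_gt0 := ltnW M_gt1; have [[divD _] _] := maxD.
have /andP[_ xM] := divD x xD.
rewrite -(count_predC [in D] (divisors M)) -card_divisor_set // ltn_add2l.
rewrite (card_divisor_set_cofactor M) // -!size_filter.
(* Besides the divisors outside [D], the element [x] of [D] also has its cofactor in [D], which
   makes the inequality strict. *)
apply: (@uniq_leq_size _ (x :: [seq d <- divisors M | d \notin D])).
  by rewrite /= filter_uniq ?divisors_uniq // mem_filter /= xD.
move=> d; rewrite inE !mem_filter -!dvdn_divisors //=.
case/orP=> [/eqP-> | /andP[dD dM]]; first by rewrite MxD.
by rewrite dM maximal_Mset_cofactor.
Qed.

Lemma divisor_set_card_le (M : nat) (D : {fset nat}) : 0 < M ->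
  divisor_set M D -> (forall x, x \in D -> M %/ x \notin D) ->
  #|` D| + #|` D| <= size (divisors M).
Proof.
move=> M_gt0 divD excl.
rewrite -(count_predC [in D] (divisors M)) -card_divisor_set // leq_add2l.
rewrite (card_divisor_set_cofactor M) //; apply: sub_count => d /=.
by apply: contraL => /excl.
Qed.

Lemma multiples_maximal_Mset (M r : nat) : 1 < M -> prime r -> r %| M ->
  maximal_Mset M [fset d in divisors M | r %| d].
Proof.
move=> M_gt1 r_pr rM; have M_gt0 := ltnW M_gt1.
apply/(maximal_MsetP _ _ M_gt1) => d; rewrite !inE /= -dvdn_divisors //.
case: (d %| M) => //=; apply/idP/allP => /= [rd e | ncd].
  rewrite !inE /= => /andP[_ re]; apply/negP => cde.
  have := dvdn_gcd r d e; rewrite rd re (eqP cde) Euclid_dvd1 //.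
have := ncd r; rewrite !inE /= -dvdn_divisors // rM dvdnn => /(_ isT).
by rewrite coprime_sym prime_coprime // negbK.
Qed.

(** If [r] divided both [x] and [M / x], then [r ^ 2] would divide their product [M]. *)
Lemma multiples_card (M r : nat) : 1 < M -> prime r -> ~~ (r ^ 2 %| M) ->
  #|` [fset d in divisors M | r %| d]| +
  #|` [fset d in divisors M | r %| d]| <= size (divisors M).
Proof.
move=> M_gt1 r_pr r2M; have M_gt0 := ltnW M_gt1.
apply: divisor_set_card_le => // x; rewrite !inE /= -!dvdn_divisors //.
  by case/andP=> xM _; rewrite xM (dvdn_gt0 M_gt0).
case/andP=> xM rx; rewrite negb_and; apply/orP; right.
by apply: contra r2M => rMx; rewrite -(divnK xM) mulnC dvdn_mul.
Qed.

(** * Splitting off the squarefree part, and minimum size *)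

Lemma coprime_cofactor (P d : nat) : 0 < P ->
  (forall q, prime q -> ~~ (q ^ 2 %| P)) -> d %| P -> coprime d (P %/ d).
Proof.
move=> P_gt0 sqfP dP; have d_gt0 := dvdn_gt0 P_gt0 dP.
rewrite /coprime eqn_leq gcdn_gt0 d_gt0 andbT leqNgt; apply/negP => g_gt1.
have := pdiv_dvd (gcdn d (P %/ d)); rewrite dvdn_gcd => /andP[qd qP].
have /negP[] := sqfP _ (pdiv_prime g_gt1).
by rewrite -[X in _ %| X](divnK dP) mulnC dvdn_mul.
Qed.

Lemma gcdn_coprime_split (Q P x : nat) : coprime Q P -> x %| Q * P ->
  x = gcdn x Q * gcdn x P.
Proof.
move=> cQP xQP; apply/eqP; rewrite eqn_dvd; apply/andP; split.
  rewrite muln_gcdl !muln_gcdr !dvdn_gcd xQP.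
  by rewrite !(dvdn_mulr _ (dvdnn x)) (dvdn_mull _ (dvdnn x)).
rewrite Gauss_dvd ?dvdn_gcdl //.
apply: (coprime_dvdl (dvdn_gcdr x Q)); exact: coprime_dvdr (dvdn_gcdr x P) cQP.
Qed.

Lemma min_maximal_primitive (Q P : nat) (D : {fset nat}) :
  0 < Q -> 1 < P -> coprime Q P ->
  (forall q, prime q -> ~~ (q ^ 2 %| P)) ->
  (forall q, prime q -> q %| Q -> q ^ 2 %| Q) ->
  min_maximal_Mset (Q * P) D -> primitive D `<=` [fset d in divisors P].
Proof.
move=> Q_gt0 P_gt1 cQP sqfP fullQ [maxD minD]; have P_gt0 := ltnW P_gt1.
have N_gt1 : 1 < Q * P by apply: leq_trans P_gt1 _; rewrite leq_pmull.
have N_gt0 := ltnW N_gt1; have [[divD _] _] := maxD.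
(* The multiples of a prime [r] of [P] form a maximal set with at most half of the divisors, so by
   minimality [D] never contains both a divisor and its cofactor. *)
have excl x : x \in D -> Q * P %/ x \notin D.
  move=> xD; apply/negP => NxD.
  have := maximal_Mset_card_gt _ _ x N_gt1 maxD xD NxD; apply/negP.
  have r_pr := pdiv_prime P_gt1; set r := pdiv P in r_pr.
  have rP : r %| P := pdiv_dvd P.
  have crQ : coprime (r ^ 2) Q.
    by rewrite coprimeXl // coprime_sym (coprime_dvdr rP).
  have r2N : ~~ (r ^ 2 %| Q * P) by rewrite Gauss_dvdr // sqfP.
  have leDE := minD _ (multiples_maximal_Mset _ _ N_gt1 r_pr (dvdn_mull Q rP)).
  by rewrite -leqNgt (leq_trans _ (multiples_card _ _ N_gt1 r_pr r2N)) ?leq_add.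
apply/fsubsetP => x; rewrite !inE /= -dvdn_divisors // => /andP[xD /hasPn primx].
have /andP[x_gt0 xN] := divD x xD.
have [xQ1 | xQ_neq1] := eqVneq (gcdn x Q) 1.
  by rewrite (gcdn_coprime_split Q P x) // xQ1 mul1n dvdn_gcdr.
(* Otherwise [x] has a prime factor [q] in common with [Q]. Writing [x = q * y], the cofactor of [x]
   is shown to lie in [D], against [excl]. *)
have xQ_gt1 : 1 < gcdn x Q by rewrite ltn_neqAle eq_sym xQ_neq1 gcdn_gt0 x_gt0.
have q_pr := pdiv_prime xQ_gt1; set q := pdiv _ in q_pr.
have : q %| gcdn x Q := pdiv_dvd _; rewrite dvdn_gcd => /andP[qx qQ].
have /dvdnP[y def_x] := qx; rewrite mulnC in def_x.
have y_gt0 : 0 < y by move: x_gt0; rewrite def_x muln_gt0 => /andP[].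
have yN : y %| Q * P by apply: dvdn_trans xN; rewrite def_x dvdn_mull.
have yD : y \notin D.
  apply/negP => /primx /=; rewrite def_x dvdn_mull // andbT negbK => /eqP eq_y.
  by have := ltn_Pmull (prime_gt1 q_pr) y_gt0; rewrite -eq_y ltnn.
have qy : ~~ (q %| y).
  by apply: contra yD; apply: maximal_Mset_divp N_gt1 maxD _; rewrite -def_x.
have defNy : Q * P %/ y = q * (Q * P %/ x).
  by rewrite -{1}(divnK xN) {2}def_x mulnA mulnK // mulnC.
(* Since [q ^ 2] divides [Q * P] and is coprime to [y], it divides the cofactor of [y], which is [q]
   times that of [x]. *)
have qNx : q %| Q * P %/ x.
  rewrite -(dvdn_pmul2l (prime_gt0 q_pr)) -defNy.
  have cq2y : coprime (q ^ 2) y by rewrite coprimeXl // prime_coprime.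
  by rewrite mulnn -(Gauss_dvdr _ cq2y) mulnC divnK // dvdn_mulr // fullQ.
have := excl x xD; rewrite (maximal_Mset_divp _ _ q _ N_gt1 maxD) //.
by rewrite -defNy maximal_Mset_cofactor.
Qed.

(** A primitive element dividing [x] also divides [P], hence divides [gcdn x P]; upward closure does
    the rest. *)
Lemma mem_gcdn_primitive (M P : nat) (D : {fset nat}) (x : nat) :
  1 < M -> 0 < P -> maximal_Mset M D ->
  primitive D `<=` [fset d in divisors P] -> x %| M ->
  (x \in D) = (gcdn x P \in D).
Proof.
move=> M_gt1 P_gt0 maxD /fsubsetP primD xM.
apply/idP/idP => [xD | ]; last first.
  by move=> gD; apply: maximal_Mset_dvd M_gt1 maxD gD (dvdn_gcdl _ _) xM.
have [e eprim ex] := primitive_below D x (dvdn_gt0 (ltnW M_gt1) xM) xD.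
have := primD e eprim; rewrite !inE -dvdn_divisors //= => eP.
move: eprim; rewrite !inE => /andP[eD _].
apply: maximal_Mset_dvd M_gt1 maxD eD _ (dvdn_trans (dvdn_gcdl _ _) xM).
by rewrite dvdn_gcd ex.
Qed.

Lemma primitive_min_maximal (Q P : nat) (D : {fset nat}) :
  0 < Q -> 1 < P -> coprime Q P ->
  (forall q, prime q -> ~~ (q ^ 2 %| P)) ->
  maximal_Mset (Q * P) D -> primitive D `<=` [fset d in divisors P] ->
  min_maximal_Mset (Q * P) D.
Proof.
move=> Q_gt0 P_gt1 cQP sqfP maxD primD; have P_gt0 := ltnW P_gt1.
have N_gt1 : 1 < Q * P by apply: leq_trans P_gt1 _; rewrite leq_pmull.
have [[divD copD] _] := maxD; split=> // E maxE.
have : #|` D| + #|` D| <= #|` E| + #|` E|.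
  apply: leq_trans (maximal_Mset_card_ge _ _ N_gt1 maxE).
  apply: divisor_set_card_le => //; first exact: ltnW.
  move=> x xD; have /andP[x_gt0 xN] := divD x xD.
  have memg := mem_gcdn_primitive _ _ _ _ N_gt1 P_gt0 maxD primD.
  apply/negP; rewrite memg ?dvdn_div // => NxD.
  move: xD; rewrite memg // => xD; have := copD _ _ xD NxD; apply/negP; rewrite negbK.
  apply: coprime_dvdr (coprime_cofactor P _ P_gt0 sqfP (dvdn_gcdr x P)).
  rewrite dvdn_divRL ?dvdn_gcdr //.
  (* The product of the two gcds divides [Q * P]; being coprime to [Q], it divides [P]. *)
  have cg : coprime (gcdn (Q * P %/ x) P * gcdn x P) Q.
    by rewrite coprime_sym coprimeMr !(coprime_dvdr (dvdn_gcdr _ P)).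
  rewrite -(Gauss_dvdr P cg).
  by rewrite -[X in _ %| X](divnK xN) dvdn_mul ?dvdn_gcdl.
by rewrite !addnn leq_double.
Qed.

(** * The product form *)

Lemma primitive_product (Q P : nat) (D : {fset nat}) :
  0 < Q -> 1 < P -> coprime Q P ->
  maximal_Mset (Q * P) D -> primitive D `<=` [fset d in divisors P] ->
  exists D' : {fset nat}, maximal_Mset P D' /\
    D = [fset d * d' | d in divisors Q, d' in D'].
Proof.
move=> Q_gt0 P_gt1 cQP maxD primD; have P_gt0 := ltnW P_gt1.
have N_gt1 : 1 < Q * P by apply: leq_trans P_gt1 _; rewrite leq_pmull.
have memg := mem_gcdn_primitive _ _ _ _ N_gt1 P_gt0 maxD primD.
have [[divD copD] _] := maxD.
exists [fset d in D | d %| P]; split.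
  apply/(maximal_MsetP _ _ P_gt1) => d; rewrite !inE /= andbC.
  have [dP /= | //] := boolP (d %| P).
  apply/idP/allP => [dD e | /= ncd]; first by rewrite !inE => /andP[eD _]; apply: copD.
  apply: contraT => dD; have dN := dvdn_mull Q dP.
  have [e eD cde] := maximal_Mset_notin _ _ _ N_gt1 maxD dN dD.
  have /andP[_ eN] := divD e eD.
  (* The element [e] of [D] need not divide [P], but [gcdn e P] does, is still in [D], and is still
     coprime to [d]. *)
  have := ncd (gcdn e P); rewrite !inE /= -memg // eD dvdn_gcdr => /(_ isT).
  by rewrite (coprime_dvdr (dvdn_gcdl e P)).
apply/fsetP => x; apply/idP/imfset2P => [xD | [d dQ [d']]].
  have /andP[_ xN] := divD x xD.
  exists (gcdn x Q); first by rewrite /= -dvdn_divisors // dvdn_gcdr.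
  exists (gcdn x P); last exact: gcdn_coprime_split.
  by rewrite !inE /= -memg // xD dvdn_gcdr.
rewrite !inE /= => /andP[d'D d'P] ->; apply: maximal_Mset_dvd N_gt1 maxD d'D _ _.
  exact: dvdn_mull.
by rewrite dvdn_mul // dvdn_divisors.
Qed.

Lemma product_maximal_primitive (Q P : nat) (D' : {fset nat}) :
  0 < Q -> 1 < P -> coprime Q P -> maximal_Mset P D' ->
  let D := [fset d * d' | d in divisors Q, d' in D'] in
  maximal_Mset (Q * P) D /\ primitive D `<=` [fset d in divisors P].
Proof.
move=> Q_gt0 P_gt1 cQP maxD' D; have P_gt0 := ltnW P_gt1.
have N_gt1 : 1 < Q * P by apply: leq_trans P_gt1 _; rewrite leq_pmull.
have [[divD' copD'] _] := maxD'.
have D'P e : e \in D' -> e %| P by case/divD'/andP.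
have DP x : reflect (exists2 d, d %| Q & exists2 d', d' \in D' & x = d * d') (x \in D).
  apply: (iffP (imfset2P _ _ _ _ _)) => -[d dQ xd]; exists d => //.
    by rewrite dvdn_divisors.
  by rewrite /= -dvdn_divisors.
have subD e : e \in D' -> e \in D.
  by move=> eD'; apply/DP; exists 1 => //; exists e; rewrite ?mul1n.
split.
  apply/(maximal_MsetP _ _ N_gt1) => x.
  apply/idP/andP => [/DP[d dQ [d' d'D ->]] | [xN /allP /= ncx]].
    split; first by rewrite dvdn_mul // D'P.
    apply/allP => _ /DP[e eQ [e' e'D ->]]; apply: contra (copD' _ _ d'D e'D).
    by rewrite coprimeMl !coprimeMr => /and3P[_ _ ->].
  apply/DP; exists (gcdn x Q); first exact: dvdn_gcdr.
  exists (gcdn x P); last exact: gcdn_coprime_split.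
  (* An [e] in [D'] coprime to [gcdn x P] would be coprime to [x], since [e] divides [P] and so is
     coprime to the factor [gcdn x Q]. *)
  apply: contraT => gD'.
  have [e eD' cge] := maximal_Mset_notin _ _ _ P_gt1 maxD' (dvdn_gcdr x P) gD'.
  have := ncx e (subD e eD'); rewrite (gcdn_coprime_split Q P x) // coprimeMl cge.
  by rewrite (coprime_dvdl (dvdn_gcdr x Q)) ?(coprime_dvdr (D'P e eD')).
apply/fsubsetP => x; rewrite !inE /= -dvdn_divisors // => /andP[/DP[d dQ [d' d'D ->]]].
(* The factor [d'] is itself in [D], so primitivity of [d * d'] forces [d * d' = d']. *)
move/hasPn/(_ d' (subD d' d'D)); rewrite dvdn_mull // andbT negbK => /eqP <-.
exact: D'P.
Qed.

(** * Prime factorizations and the equivalences *)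

Lemma prime_dvd_prodP (I : finType) (S : pred I) (p a : I -> nat) (q : nat) :
  prime q -> (forall i, prime (p i)) -> q %| \prod_(i | S i) p i ^ a i ->
  exists2 i, S i & q = p i.
Proof.
move=> q_pr p_pr; rewrite Euclid_dvd_prod // big_orE => /exists_inP[i Si].
by rewrite Euclid_dvdX // dvdn_prime2 // => /andP[/eqP]; exists i.
Qed.

Theorem theorem2 (n u : nat) (p alpha : 'I_n -> nat) (N P : nat)
  (p_prime : forall i, prime (p i))
  (p_inj : injective p)
  (alpha_noninc : forall i j : 'I_n, i <= j -> alpha j <= alpha i)
  (u_lt_n : u < n)
  (alpha_gt1 : forall i : 'I_n, i < u -> 1 < alpha i)
  (alpha_eq1 : forall i : 'I_n, u <= i -> alpha i = 1)
  (defN : N = \prod_(i < n) p i ^ alpha i)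
  (defP : P = \prod_(i < n | u <= i) p i)
  (D : {fset nat}) (D_div : divisor_set N D) :
  (min_maximal_Mset N D <->
     maximal_Mset N D /\ primitive D `<=` [fset d in divisors P]) /\
  (maximal_Mset N D /\ primitive D `<=` [fset d in divisors P] <->
     exists D' : {fset nat}, maximal_Mset P D' /\
       D = [fset d * d' | d in divisors (N %/ P), d' in D']).
Proof.
pose Q := \prod_(i < n | i < u) p i ^ alpha i.
(* Exponents [1] are made explicit so that [prime_dvd_prodP] also applies to the factors of [P]. *)
have powP (S : pred 'I_n) : \prod_(i | S i) p i = \prod_(i | S i) p i ^ 1.
  by apply: eq_bigr => i _; rewrite expn1.
have Q_gt0 : 0 < Q by apply: prodn_cond_gt0 => i _; rewrite expn_gt0 prime_gt0.
have P_gt0 : 0 < P by rewrite defP; apply: prodn_cond_gt0 => i _; apply: prime_gt0.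
(* As [u < n], the prime of index [u] divides [P]. *)
have P_gt1 : 1 < P.
  apply: leq_trans (prime_gt1 (p_prime (Ordinal u_lt_n))) (dvdn_leq P_gt0 _).
  by rewrite defP (bigD1 (Ordinal u_lt_n)) //= dvdn_mulr.
have cQP : coprime Q P.
  apply: contraT; rewrite /coprime => g_neq1.
  have g_gt1 : 1 < gcdn Q P by rewrite ltn_neqAle eq_sym g_neq1 gcdn_gt0 Q_gt0.
  have q_pr := pdiv_prime g_gt1; set q := pdiv _ in q_pr.
  have : q %| gcdn Q P := pdiv_dvd _; rewrite dvdn_gcd => /andP[].
  case/(prime_dvd_prodP _ _ _ _ _ q_pr p_prime)=> i lt_iu def_i.
  rewrite [X in _ %| X]defP powP.
  case/(prime_dvd_prodP _ _ _ _ _ q_pr p_prime)=> j le_uj.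
  by rewrite def_i => /p_inj eq_ij; rewrite -eq_ij leqNgt lt_iu in le_uj.
have sqfP q : prime q -> ~~ (q ^ 2 %| P).
  move=> q_pr; apply/negP => q2P.
  have : q %| P by apply: dvdn_trans q2P; rewrite dvdn_mulr.
  rewrite defP powP => /(prime_dvd_prodP _ _ _ _ _ q_pr p_prime)[j le_uj def_q].
  move: q2P; rewrite defP (bigD1 j) //= -def_q -mulnn dvdn_pmul2l ?prime_gt0 //.
  rewrite powP => /(prime_dvd_prodP _ _ _ _ _ q_pr p_prime)[k /andP[_ k_neqj]].
  by rewrite def_q => /p_inj eq_jk; rewrite eq_jk eqxx in k_neqj.
have fullQ q : prime q -> q %| Q -> q ^ 2 %| Q.
  move=> q_pr /(prime_dvd_prodP _ _ _ _ _ q_pr p_prime)[i lt_iu ->].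
  by rewrite /Q (bigD1 i) //= dvdn_mulr // dvdn_exp2l // alpha_gt1.
have {}defN : N = Q * P.
  rewrite defN (bigID (fun i : 'I_n => i < u)) /= defP; congr (_ * _).
  by apply: eq_big => i; rewrite -leqNgt // => /alpha_eq1->; rewrite expn1.
rewrite defN mulnK //; split; split.
- move=> minD; split; first by case: minD.
  exact: min_maximal_primitive minD.
- by case=> maxD primD; apply: primitive_min_maximal.
- by case=> maxD primD; apply: primitive_product.
- by case=> D' [maxD' ->]; apply: product_maximal_primitive.
Qed.
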